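(* Let $\lambda,T,L_1,L_2>0$, $u_0:\mathbb{R}^2\to\mathbb{R}$, and let $u_f,v_f,w_f$ be the fine-grid functions produced by Steps 1 and 2 of the two-grid scheme described in the context. Let $\eta\in\mathcal{V}_h^f$ and $\varepsilon^{n-\frac12}\in\mathcal{V}_h^f$ ($1\le n\le N^f$) be perturbations, and let $\hat u^n,\hat v^n,\hat w^n\in\mathcal{V}_h^f$ ($0\le n\le N^f$) be the solution of the residual system: for all $(x_i,y_j)\in\Omega_h^f$, $$\delta_t^f\hat u_{ij}^{n-\frac12}+\psi_h^f\big(u_f^{n-\frac12},\hat u^{n-\frac12}\big)_{ij}-\frac{h_f^2}{2}\Big[\psi_x^f\big(v_f^{n-\frac12},\hat u^{n-\frac12}\big)_{ij}+\psi_y^f\big(w_f^{n-\frac12},\hat u^{n-\frac12}\big)_{ij}\Big]=\lambda\big(\hat v_{ij}^{n-\frac12}+\hat w_{ij}^{n-\frac12}\big)+\varepsilon_{ij}^{n-\frac12},\quad 1\le n\le N^f,$$ $$\hat v_{ij}^n=\delta_{xx}^f\hat u_{ij}^n-\frac{h_f^2}{12}\delta_{xx}^f\hat v_{ij}^n,\qquad \hat w_{ij}^n=\delta_{yy}^f\hat u_{ij}^n-\frac{h_f^2}{12}\delta_{yy}^f\hat w_{ij}^n,\quad 0\le n\le N^f,$$ $$\hat u_{ij}^0=\eta_{ij}.$$ Then for every $1\le n\le N^f$, $$\|\hat u^n\|^2\le\exp(2T)\Big(2\|\eta\|^2+2\tau_f\sum_{k=1}^n\|\varepsilon^{k-\f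rac12}\|^2\Big).$$
   Context: The residual system is satisfied by the difference between a solution of the fine-grid linear scheme perturbed by $\varepsilon$ (right-hand side) and $\eta$ (initial data) and the solution of the unperturbed scheme. **Grids.** $M_1^c,M_2^c,N^c,k_h,k_\tau$ are positive integers with $L_1=h_cM_1^c$, $L_2=h_cM_2^c$ for a common coarse spatial step $h_c>0$, and $\tau_c=T/N^c$. The fine grid has $h_f=h_c/k_h$, $\tau_f=\tau_c/k_\tau$, $M_1^f=k_hM_1^c$, $M_2^f=k_hM_2^c$, $N^f=k_\tau N^c$. For $\sigma\in\{c,f\}$, the grid points are $x_a=ah_\sigma$, $y_b=bh_\sigma$, $t_d=d\tau_\sigma$; $\Omega_h^\sigma=\{(x_a,y_b):1\le a\le M_1^\sigma,\,1\le b\le M_2^\sigma\}$, $\Omega_\tau^\sigma=\{t_d:0\le d\le N^\sigma\}$. $\mathcal{V}_h^\sigma$ is the space of real grid functions $v=\{v_{ab}\}_{a,b\in\mathbb{Z}}$ with $v_{a+M_1^\sigma,b}=v_{ab}$, $v_{a,b+M_2^\sigma}=v_{ab}$. The fine-grid norm is $\|v\|=\big(h_f^2\sum_{a=1}^{M_1^f}\sum_{b=1}^{M_2^f}v_{ab}^2\big)^{1/2}$. **Difference operators** ($\sigma\in\{c,f\}$). $v_{ab}^{d-\frac12}=\frac12(v_{ab}^d+v_{ab}^{d-1})$ for time-dependent grid functions defined at integer levels (the perturbations $\varepsilon^{n-\frac12}$ are given directly), $\delta_t^\sigma v_{ab}^{d-\frac12}=\frac1{\tau_\sigma}(v_{ab}^d-v_{ab}^{d-1})$,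 $\widehat\delta_x^\sigma v_{ab}=\frac{1}{2h_\sigma}(v_{a+1,b}-v_{a-1,b})$, $\widehat\delta_y^\sigma v_{ab}=\frac{1}{2h_\sigma}(v_{a,b+1}-v_{a,b-1})$, $\widehat\delta_h^\sigma=\widehat\delta_x^\sigma+\widehat\delta_y^\sigma$, $\delta_{xx}^\sigma v_{ab}=\frac1{h_\sigma^2}(v_{a+1,b}-2v_{ab}+v_{a-1,b})$, $\delta_{yy}^\sigma v_{ab}=\frac1{h_\sigma^2}(v_{a,b+1}-2v_{ab}+v_{a,b-1})$. With $(uv)_{ab}=u_{ab}v_{ab}$, the bilinear operators are $\psi_\ast^\sigma(u,v)_{ab}=\frac13\big(u_{ab}\widehat\delta_\ast^\sigma v_{ab}+\widehat\delta_\ast^\sigma(uv)_{ab}\big)$ for $\ast\in\{x,y,h\}$. **Step 1 (coarse nonlinear scheme).** $(u_c)^r,(v_c)^r,(w_c)^r\in\mathcal{V}_h^c$, $0\le r\le N^c$, solve, for all $(x_p,y_q)\in\Omega_h^c$, $$\delta_t^c(u_c)_{pq}^{r-\frac12}+\psi_h^c\big(u_c^{r-\frac12},u_c^{r-\frac12}\big)_{pq}-\frac{h_c^2}{2}\Big[\psi_x^c\big(v_c^{r-\frac12},u_c^{r-\frac12}\big)_{pq}+\psi_y^c\big(w_c^{r-\frac12},u_c^{r-\frac12}\big)_{pq}\Big]=\lambda\big((v_c)_{pq}^{r-\frac12}+(w_c)_{pq}^{r-\frac12}\big)\quad(1\le r\le N^c),$$ $(v_c)_{pq}^r=\delta_{xx}^c(u_c)_{pq}^r-\frac{h_c^2}{12}\delta_{xx}^c(v_c)_{pq}^r$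 and $(w_c)_{pq}^r=\delta_{yy}^c(u_c)_{pq}^r-\frac{h_c^2}{12}\delta_{yy}^c(w_c)_{pq}^r$ for $0\le r\le N^c$, and $(u_c)_{pq}^0=u_0(x_p,y_q)$. **Step 2 (interpolation).** In time, at coarse spatial nodes: $(u_f)_{pk_h,qk_h}^{(r-1)k_\tau+s}=(1-\frac{s}{k_\tau})(u_c)_{pq}^{r-1}+\frac{s}{k_\tau}(u_c)_{pq}^r$ for $1\le r\le N^c$, $0\le s\le k_\tau$. In space, for $0\le n\le N^f$, $0\le p\le M_1^c-1$, $0\le q\le M_2^c-1$, $0\le l,m\le k_h-1$: $$(u_f)_{pk_h+l,qk_h+m}^n=\sum_{i=0}^3\sum_{j=0}^3(u_f)_{(p+i)k_h,(q+j)k_h}^n\,\mu_i(x_{pk_h+l})\,\omega_j(y_{qk_h+m}),$$ $$\mu_i(x)=\prod_{0\le s\le3,\,s\ne i}\frac{x-x_{(p+s)k_h}}{x_{(p+i)k_h}-x_{(p+s)k_h}},\qquad \omega_j(y)=\prod_{0\le s\le3,\,s\ne j}\frac{y-y_{(q+s)k_h}}{y_{(q+j)k_h}-y_{(q+s)k_h}},$$ with fine-grid nodes $x_a=ah_f$, $y_b=bh_f$ and values extended periodically, so $u_f^n\in\mathcal{V}_h^f$. Then $v_f^n,w_f^n\in\mathcal{V}_h^f$ are defined by $(v_f)_{ij}^n=\delta_{xx}^f(u_f)_{ij}^n-\frac{h_f^2}{12}\delta_{xx}^f(v_f)_{ij}^n$ and $(w_f)_{ij}^n=\delta_{yy}^f(u_f)_{ij}^n-\frac{h_f^2}{12}\delta_{yy}^f(w_f)_{ij}^n$.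 *)

(* Defs.v *)
From HB Require Import structures.
From mathcomp Require Import all_boot all_order all_algebra.
From mathcomp Require Import reals sequences exp.

Set Implicit Arguments.
Unset Strict Implicit.
Unset Printing Implicit Defensive.

Import Order.TTheory GRing.Theory Num.Theory.
Local Open Scope ring_scope.

(* Data of the grid sigma : h_sigma, tau_sigma, M_1^sigma, M_2^sigma and
   N^sigma. *)
Record grid (R : realType) := Grid {
  hstep : R;
  tstep : R;
  dim1 : nat;
  dim2 : nat;
  levels : nat
}.

Definition refine_grid (R : realType) (kh kt : nat) (G : grid R) : grid R :=
  Grid (hstep G / kh%:R) (tstep G / kt%:R)
       (kh * dim1 G)%N (kh * dim2 G)%N (kt * levels G)%N.

Section Grids.
Variables (R : realType) (G : grid R).

Let h := hstep G.
Let tau := tstep G.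

Definition xpt (a : int) : R := a%:~R * h.

(* Index pairs (a, b) such that (x_a, y_b) lies in Omega_h. *)
Definition in_Omega (a b : int) : bool :=
  (1 <= a <= (dim1 G)%:Z) && (1 <= b <= (dim2 G)%:Z).

Definition in_Vh (v : int -> int -> R) : Prop :=
  forall a b : int,
    v (a + (dim1 G)%:Z) b = v a b /\ v a (b + (dim2 G)%:Z) = v a b.

Definition grid_norm (v : int -> int -> R) : R :=
  Num.sqrt (h ^+ 2 * \sum_(1 <= a < (dim1 G).+1) \sum_(1 <= b < (dim2 G).+1)
                       v a%:Z b%:Z ^+ 2).

(* Half levels are indexed by their upper neighbour: the level d - 1/2 is
   represented by d, and is only meaningful for d >= 1. *)
Definition avg (v : nat -> int -> int -> R) (d : nat) (a b : int) : R :=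
  2^-1 * (v d a b + v d.-1 a b).

Definition dt (v : nat -> int -> int -> R) (d : nat) (a b : int) : R :=
  tau^-1 * (v d a b - v d.-1 a b).

Definition dx (v : int -> int -> R) (a b : int) : R :=
  (2 * h)^-1 * (v (a + 1) b - v (a - 1) b).

Definition dy (v : int -> int -> R) (a b : int) : R :=
  (2 * h)^-1 * (v a (b + 1) - v a (b - 1)).

Definition dh (v : int -> int -> R) (a b : int) : R := dx v a b + dy v a b.

Definition dxx (v : int -> int -> R) (a b : int) : R :=
  (h ^+ 2)^-1 * (v (a + 1) b - 2 * v a b + v (a - 1) b).

Definition dyy (v : int -> int -> R) (a b : int) : R :=
  (h ^+ 2)^-1 * (v a (b + 1) - 2 * v a b + v a (b - 1)).

Definition psi (delta : (int -> int -> R) -> int -> int -> R)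
    (u v : int -> int -> R) (a b : int) : R :=
  3^-1 * (u a b * delta v a b + delta (fun i j => u i j * v i j) a b).

Definition psi_x := psi dx.
Definition psi_y := psi dy.
Definition psi_h := psi dh.

(* psi_h(U,z) - h^2/2 [psi_x(V,z) + psi_y(W,z)] : in the nonlinear scheme
   z = U, in the linear one (U,V,W) is the interpolated coarse solution. *)
Definition convection (U V W z : int -> int -> R) (a b : int) : R :=
  psi_h U z a b - h ^+ 2 / 2 * (psi_x V z a b + psi_y W z a b).

Definition compact_rel (u v w : int -> int -> R) : Prop :=
  forall i j : int, in_Omega i j ->
    v i j = dxx u i j - h ^+ 2 / 12 * dxx v i j /\
    w i j = dyy u i j - h ^+ 2 / 12 * dyy w i j.

Definition nonlinear_scheme (lam : R) (u0 : R * R -> R)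
    (u v w : nat -> int -> int -> R) : Prop :=
  [/\ forall r : nat, (r <= levels G)%N ->
        [/\ in_Vh (u r), in_Vh (v r) & in_Vh (w r)],
      forall r : nat, (1 <= r <= levels G)%N ->
        forall p q : int, in_Omega p q ->
          dt u r p q + convection (avg u r) (avg v r) (avg w r) (avg u r) p q
          = lam * (avg v r p q + avg w r p q),
      forall r : nat, (r <= levels G)%N -> compact_rel (u r) (v r) (w r)
    & forall p q : int, in_Omega p q -> u 0%N p q = u0 (xpt p, xpt q)].

(* eps n stands for the perturbation at level n - 1/2. *)
Definition residual_system (lam : R) (U V W eps : nat -> int -> int -> R)
    (eta : int -> int -> R) (u v w : nat -> int -> int -> R) : Prop :=
  [/\ forall n : nat, (n <= levels G)%N ->
        [/\ in_Vh (u n), in_Vh (v n) & in_Vh (w n)],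
      forall n : nat, (1 <= n <= levels G)%N ->
        forall i j : int, in_Omega i j ->
          dt u n i j + convection (avg U n) (avg V n) (avg W n) (avg u n) i j
          = lam * (avg v n i j + avg w n i j) + eps n i j,
      forall n : nat, (n <= levels G)%N -> compact_rel (u n) (v n) (w n)
    & forall i j : int, in_Omega i j -> u 0%N i j = eta i j].

End Grids.

Definition lagrange_basis (R : realType) (node : 'I_4 -> R) (i : 'I_4) (x : R) : R :=
  \prod_(s < 4 | s != i) ((x - node s) / (node i - node s)).

(* Gc is the coarse grid; uc is given on Gc, and (uf, vf, wf) on the grid
   refined kh times in each spatial direction and kt times in time. *)
Definition interpolation (R : realType) (Gc : grid R) (kh kt : nat)
    (uc uf vf wf : nat -> int -> int -> R) : Prop :=
  let Gf := refine_grid kh kt Gc in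
  let node (p : nat) (s : 'I_4) : int := (((p + s) * kh)%N)%:Z in
  [/\ forall n : nat, (n <= levels Gf)%N ->
        [/\ in_Vh Gf (uf n), in_Vh Gf (vf n) & in_Vh Gf (wf n)],
      forall r s : nat, (1 <= r <= levels Gc)%N -> (s <= kt)%N ->
        forall p q : int,
          uf (r.-1 * kt + s)%N (p * kh%:Z) (q * kh%:Z)
          = (1 - s%:R / kt%:R) * uc r.-1 p q + s%:R / kt%:R * uc r p q,
      forall n p q l m : nat, (n <= levels Gf)%N ->
        (p < dim1 Gc)%N -> (q < dim2 Gc)%N -> (l < kh)%N -> (m < kh)%N ->
          let a := ((p * kh + l)%N)%:Z in
          let b := ((q * kh + m)%N)%:Z in
          uf n a b
          = \sum_(i < 4) \sum_(j < 4)
              uf n (node p i) (node q j)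
              * lagrange_basis (fun s => xpt Gf (node p s)) i (xpt Gf a)
              * lagrange_basis (fun s => xpt Gf (node q s)) j (xpt Gf b)
    & forall n : nat, (n <= levels Gf)%N ->
        compact_rel Gf (uf n) (vf n) (wf n)].

(* Main.v *)
(* The bilinear forms psi are skew in their second argument by periodic
   summation by parts, and the compact difference operators relating v, w to u
   are negative, so testing the scheme with the time average of u^n and u^{n-1}
   leaves only the perturbation. Together with Cauchy-Schwarz this gives
   |u^n| <= |u^{n-1}| + tau |eps^n| without any condition on tau or any Gronwall
   argument. Summing, squaring and using (sum_{k <= n} |eps^k|)^2 <= n sum |eps^k|^2
   with n tau <= T gives the bound with the constant max(1, T) <= exp(2 T). *)
Require Import Defs.
From HB Require Import structures.
From mathcomp Require Import all_boot all_order all_algebra.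
From mathcomp Require Import reals sequences exp.
From mathcomp Require Import ring lra.

Set Implicit Arguments.
Unset Strict Implicit.
Unset Printing Implicit Defensive.

Import Order.TTheory GRing.Theory Num.Theory.
Local Open Scope ring_scope.

(** * Cauchy-Schwarz for finite sums *)

Lemma sum_CauchySchwarz (R : realFieldType) (I : Type) (r : seq I) (f g : I -> R) :
  (\sum_(i <- r) f i * g i) ^+ 2
  <= (\sum_(i <- r) f i ^+ 2) * (\sum_(i <- r) g i ^+ 2).
Proof.
set p := \sum_(i <- r) f i * g i.
set F := \sum_(i <- r) f i ^+ 2; set Q := \sum_(i <- r) g i ^+ 2.
have quad x : 0 <= x ^+ 2 * F + 2 * x * p + Q.
  have -> : x ^+ 2 * F + 2 * x * p + Q = \sum_(i <- r) (x * f i + g i) ^+ 2.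
    rewrite /F /p /Q !mulr_sumr -!big_split /=.
    by apply: eq_bigr => i _; ring.
  by apply: sumr_ge0 => i _; exact: sqr_ge0.
have F_ge0 : 0 <= F by apply: sumr_ge0 => i _; exact: sqr_ge0.
have [F0|F_neq0] := eqVneq F 0.
  have [p0|p_neq0] := eqVneq p 0; first by rewrite p0 F0; lra.
  (* For [F = 0] the quadratic is affine in [x]; this root of [2 * x * p + Q = -1] contradicts its
     nonnegativity. *)
  have := quad (- (Q + 1) / (2 * p)).
  have -> : 2 * (- (Q + 1) / (2 * p)) * p = - (Q + 1) by field.
  by rewrite F0; lra.
have F_gt0 : 0 < F by rewrite lt_def F_neq0.
(* The minimiser of the quadratic. *)
have := quad (- (p / F)).
have -> : (- (p / F)) ^+ 2 * F + 2 * - (p / F) * p + Q = (F * Q - p ^+ 2) / F.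
  by field.
by rewrite pmulr_lge0 ?invr_gt0// subr_ge0.
Qed.

(** * Summation by parts over one period, in one space variable *)

Section Periodic.
Variables (R : realFieldType) (M : nat).
Implicit Types F U u v z : int -> R.

Let periodic F := forall a : int, F (a + M%:Z) = F a.

(** The sum telescopes to [F (M + 1) - F 1]. Writing 0 as such a sum reduces the next two lemmas to
    pointwise algebra. *)
Lemma sum_shift_periodic F : periodic F ->
  \sum_(1 <= a < M.+1) (F (a%:Z + 1) - F a%:Z) = 0.
Proof.
move=> perF; under eq_bigr => a _ do rewrite -PoszD addn1.
rewrite (telescope_sumr (fun a : nat => F a%:Z))//.
by rewrite -[M.+1]add1n PoszD perF subrr.
Qed.

(* The summand is [F (a + 1) - F a] for
   [F a = (6 h)^-1 (U (a - 1) + U a) z (a - 1) z a]. *)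
Lemma sum_skew_periodic (h : R) U z : periodic U -> periodic z ->
  \sum_(1 <= a < M.+1)
    3^-1 * (U a%:Z * ((2 * h)^-1 * (z (a%:Z + 1) - z (a%:Z - 1)))
            + (2 * h)^-1 * (U (a%:Z + 1) * z (a%:Z + 1)
                            - U (a%:Z - 1) * z (a%:Z - 1))) * z a%:Z = 0.
Proof.
move=> perU perz.
pose F a := 3^-1 * (2 * h)^-1 * ((U (a - 1) + U a) * z (a - 1) * z a).
rewrite -[RHS](@sum_shift_periodic F); last first.
  by move=> a; rewrite /F (addrAC a) !perU !perz.
by apply: eq_bigr => a _; rewrite /F addrK; ring.
Qed.

(* With [A] the second difference quotient, [A u = v + h^2/12 A v], hence
   [<v, u> = <A u, u> - h^2/12 |v|^2 - (h^2/12)^2 <A v, v>]. The first term is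
   [<= 0], and the inverse inequality [- <A v, v> <= 4/h^2 |v|^2] lets the second
   absorb the third. *)
Lemma sum_compact_le0 (h : R) u v : h != 0 -> periodic u -> periodic v ->
  (forall a : nat, (1 <= a < M.+1)%N ->
    v a%:Z = (h ^+ 2)^-1 * (u (a%:Z + 1) - 2 * u a%:Z + u (a%:Z - 1))
      - h ^+ 2 / 12 *
        ((h ^+ 2)^-1 * (v (a%:Z + 1) - 2 * v a%:Z + v (a%:Z - 1)))) ->
  \sum_(1 <= a < M.+1) v a%:Z * u a%:Z <= 0.
Proof.
move=> h0 peru perv vE.
pose c := (h ^+ 2)^-1.
(* Boundary terms of the summations by parts: of <A u, u>, of the symmetry <A v, u> = <v, A u>, and
   of <A v, v>. The term [- 2 * v a ^+ 2] makes the inverse inequality pointwise, through the square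
   of [v1 + v0] below. *)
pose F a := c * ((u a - u (a - 1)) * u a)
  - 12^-1 * (v a * u (a - 1) - v (a - 1) * u a)
  - h ^+ 2 / 144 * ((v a - v (a - 1)) * v a - 2 * v a ^+ 2).
rewrite -[leRHS](@sum_shift_periodic F); last first.
  by move=> a; rewrite /F (addrAC a) !peru !perv.
apply: ler_sum_nat => a aM; rewrite /F addrK.
have := vE a aM.
move: (u (a%:Z + 1)) (u a%:Z) (u (a%:Z - 1)) (v (a%:Z + 1)) (v a%:Z) (v (a%:Z - 1)).
move=> u1 u0 um v1 v0 vm vE0.
have u1E : u1 = 2 * u0 - um + h ^+ 2 * (v0 + 12^-1 * (v1 - 2 * v0 + vm)).
  by rewrite {1}vE0; field.
rewrite -subr_ge0.
(* The coefficient 1/18 is 1/12 - 4/144, what remains of |v|^2 after the absorption. *)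
rewrite [X in 0 <= X](_ : _ = c * (u1 - u0) ^+ 2 + h ^+ 2 / 18 * v0 ^+ 2
    + h ^+ 2 / 144 * (v1 + v0) ^+ 2); last by rewrite u1E /c; field.
by rewrite !addr_ge0// mulr_ge0 ?sqr_ge0// ?invr_ge0 ?divr_ge0 ?sqr_ge0.
Qed.

End Periodic.

(** * Sums and norms of grid functions in two dimensions *)

Section GridFunctions.
Variables (R : realType) (G : grid R).
Implicit Types f g u v w z : int -> int -> R.

Local Notation h := (hstep G).
Local Notation tau := (tstep G).

(** The weight h^2 of the discrete inner product is left out; it returns only where norms enter. *)
Definition grid_sum f : R :=
  \sum_(1 <= a < (dim1 G).+1) \sum_(1 <= b < (dim2 G).+1) f a%:Z b%:Z.

Lemma in_Omega_nat (a b : nat) : in_Omega G a%:Z b%:Z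
  = (1 <= a < (dim1 G).+1)%N && (1 <= b < (dim2 G).+1)%N.
Proof. by rewrite /in_Omega !lez_nat. Qed.

Lemma eq_grid_sum f g :
  (forall i j, in_Omega G i j -> f i j = g i j) -> grid_sum f = grid_sum g.
Proof.
move=> fg; apply: eq_big_nat => a /andP[a1 aM].
by apply: eq_big_nat => b /andP[b1 bM]; apply: fg; rewrite in_Omega_nat a1 aM b1.
Qed.

Lemma grid_sumD f g :
  grid_sum (fun i j => f i j + g i j) = grid_sum f + grid_sum g.
Proof. by rewrite -big_split; apply: eq_bigr => a _; rewrite -big_split. Qed.

Lemma grid_sumZ c f : grid_sum (fun i j => c * f i j) = c * grid_sum f.
Proof. by rewrite mulr_sumr; apply: eq_bigr => a _; rewrite mulr_sumr. Qed.

Lemma grid_sum_ge0 f : (forall i j, 0 <= f i j) -> 0 <= grid_sum f.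
Proof. by move=> f0; apply: sumr_ge0 => a _; apply: sumr_ge0 => b _. Qed.

Lemma grid_norm_sqr f : grid_norm G f ^+ 2 = h ^+ 2 * grid_sum (fun i j => f i j ^+ 2).
Proof.
rewrite sqr_sqrtr// mulr_ge0 ?sqr_ge0//.
by apply: (@grid_sum_ge0 (fun i j => f i j ^+ 2)) => i j; exact: sqr_ge0.
Qed.

Lemma grid_norm_ge0 f : 0 <= grid_norm G f.
Proof. exact: sqrtr_ge0. Qed.

Lemma grid_CauchySchwarz f g :
  h ^+ 2 * grid_sum (fun i j => f i j * g i j) <= grid_norm G f * grid_norm G g.
Proof.
(* Listing the index pairs turns the double sum into a single one. *)
pose r := [seq (a, b) | a <- index_iota 1 (dim1 G).+1, b <- index_iota 1 (dim2 G).+1].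
have sumE F : grid_sum F = \sum_(i <- r) F i.1%:Z i.2%:Z by rewrite big_allpairs.
apply: le_trans (ler_norm _) _.
rewrite -ler_sqr ?nnegrE ?mulr_ge0 ?grid_norm_ge0// -normrX ger0_norm ?sqr_ge0//.
rewrite !exprMn !grid_norm_sqr [leRHS]mulrACA -expr2 ler_wpM2l ?sqr_ge0// !sumE.
exact: sum_CauchySchwarz.
Qed.

(** * Skewness of the convection and sign of the dissipation, one grid line at a time *)

Lemma psi_x_skew U z : in_Vh G U -> in_Vh G z ->
  grid_sum (fun i j => psi_x G U z i j * z i j) = 0.
Proof.
move=> perU perz; rewrite /grid_sum exchange_big big1// => b _.
by apply: (@sum_skew_periodic _ _ h (U^~ b%:Z) (z^~ b%:Z)) => a;
  [case: (perU a b) | case: (perz a b)].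
Qed.

Lemma psi_y_skew U z : in_Vh G U -> in_Vh G z ->
  grid_sum (fun i j => psi_y G U z i j * z i j) = 0.
Proof.
move=> perU perz; rewrite /grid_sum big1// => a _.
by apply: (@sum_skew_periodic _ _ h (U a%:Z) (z a%:Z)) => b;
  [case: (perU a b) | case: (perz a b)].
Qed.

(** Since [dh] is [dx] plus [dy], [psi_h] splits into [psi_x] and [psi_y], and every term is skew in
    a single direction. *)
Lemma convection_skew U V W z :
  in_Vh G U -> in_Vh G V -> in_Vh G W -> in_Vh G z ->
  grid_sum (fun i j => convection G U V W z i j * z i j) = 0.
Proof.
move=> perU perV perW perz.
rewrite (@eq_grid_sum _ (fun i j =>
    psi_x G U z i j * z i j + psi_y G U z i j * z i j
    + - (h ^+ 2 / 2) * (psi_x G V z i j * z i j + psi_y G W z i j * z i j))).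
  rewrite grid_sumD grid_sumZ !grid_sumD !psi_x_skew// !psi_y_skew//.
  by rewrite !addr0 mulr0 addr0.
move=> i j _.
by rewrite /convection /psi_h /psi_x /psi_y /psi /dh; ring.
Qed.

Lemma compact_rel_le0 u v w : h != 0 ->
  in_Vh G u -> in_Vh G v -> in_Vh G w -> compact_rel G u v w ->
  grid_sum (fun i j => (v i j + w i j) * u i j) <= 0.
Proof.
move=> h0 peru perv perw uvw.
rewrite (@eq_grid_sum _ (fun i j => v i j * u i j + w i j * u i j)); last first.
  by move=> i j _; rewrite mulrDl.
rewrite grid_sumD -[leRHS]addr0; apply: lerD.
- rewrite /grid_sum exchange_big big_nat; apply: sumr_le0 => b /andP[b1 bM].
  apply: (@sum_compact_le0 _ _ h (u^~ b%:Z) (v^~ b%:Z)) => //.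
  + by move=> a; case: (peru a b).
  + by move=> a; case: (perv a b).
  + move=> a /andP[a1 aM]; have [|+ _] := uvw a%:Z b%:Z; first by rewrite in_Omega_nat a1 aM b1.
    by [].
- rewrite /grid_sum big_nat; apply: sumr_le0 => a /andP[a1 aM].
  apply: (@sum_compact_le0 _ _ h (u a%:Z) (w a%:Z)) => //.
  + by move=> b; case: (peru a b).
  + by move=> b; case: (perw a b).
  + move=> b /andP[b1 bM]; have [|_ +] := uvw a%:Z b%:Z; first by rewrite in_Omega_nat a1 aM b1.
    by [].
Qed.

(** * One time step of the residual system *)

Lemma in_Vh_avg (u : nat -> int -> int -> R) n :
  in_Vh G (u n) -> in_Vh G (u n.-1) -> in_Vh G (avg u n).
Proof.
move=> per per' a b; rewrite /avg.
by have [-> ->] := per a b; have [-> ->] := per' a b.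
Qed.

(** The relation is linear, so it passes to the half levels, where the scheme is tested. *)
Lemma compact_rel_avg (u v w : nat -> int -> int -> R) n :
  compact_rel G (u n) (v n) (w n) ->
  compact_rel G (u n.-1) (v n.-1) (w n.-1) ->
  compact_rel G (avg u n) (avg v n) (avg w n).
Proof.
move=> uvw uvw' i j ij; have [vE wE] := uvw _ _ ij; have [vE' wE'] := uvw' _ _ ij.
by split; rewrite {1}/avg; [rewrite {1}vE {1}vE'|rewrite {1}wE {1}wE'];
  rewrite /dxx /dyy /avg; ring.
Qed.

(* Testing the scheme with [avg u n] leaves
   [|u^n|^2 - |u^{n-1}|^2 <= tau <eps^n, u^n + u^{n-1}>
                          <= tau |eps^n| (|u^n| + |u^{n-1}|)],
   and the factor [|u^n| + |u^{n-1}|] cancels. *)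
Lemma residual_system_step lam (U V W eps : nat -> int -> int -> R) eta
    (u v w : nat -> int -> int -> R) n :
  0 < h -> 0 < tau -> 0 <= lam ->
  (forall k, (k <= levels G)%N -> [/\ in_Vh G (U k), in_Vh G (V k) & in_Vh G (W k)]) ->
  residual_system G lam U V W eps eta u v w ->
  (1 <= n <= levels G)%N ->
  grid_norm G (u n) <= grid_norm G (u n.-1) + tau * grid_norm G (eps n).
Proof.
move=> h_gt0 tau_gt0 lam_ge0 perUVW [peruvw eqn uvw _] n_range.
have /andP[n1 nN] := n_range.
have n'N : (n.-1 <= levels G)%N by apply: leq_trans nN; exact: leq_pred.
have [perU perV perW] := perUVW _ nN; have [perU' perV' perW'] := perUVW _ n'N.
have [peru perv perw] := peruvw _ nN; have [peru' perv' perw'] := peruvw _ n'N.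
have conv0 := convection_skew (in_Vh_avg perU perU') (in_Vh_avg perV perV')
  (in_Vh_avg perW perW') (in_Vh_avg peru peru').
have diss := compact_rel_le0 (lt0r_neq0 h_gt0) (in_Vh_avg peru peru')
  (in_Vh_avg perv perv') (in_Vh_avg perw perw')
  (compact_rel_avg (uvw _ nN) (uvw _ n'N)).
have balance : grid_sum (fun i j => u n i j ^+ 2)
    = grid_sum (fun i j => u n.-1 i j ^+ 2)
      + (2 * tau * lam * grid_sum (fun i j => (avg v n i j + avg w n i j) * avg u n i j)
         + tau * (grid_sum (fun i j => eps n i j * u n i j)
                  + grid_sum (fun i j => eps n i j * u n.-1 i j))).
  (* The vanishing convection sum, times [2 * tau], is added on the left; the two summands then
     agree pointwise by the scheme. *)
  rewrite -[LHS]addr0 -(mulr0 (2 * tau)) -conv0 -!grid_sumZ -!grid_sumD -!grid_sumZ -!grid_sumD.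
  apply: eq_grid_sum => i j ij.
  have /(congr1 (fun x => 2 * tau * x * avg u n i j)) := eqn _ n_range _ _ ij.
  rewrite /= mulrDr mulrDl.
  have -> : 2 * tau * dt G u n i j * avg u n i j = u n i j ^+ 2 - u n.-1 i j ^+ 2.
    by rewrite /dt /avg; field; rewrite lt0r_neq0.
  move=> /(canRL (addrK _)) /(canRL (subrK _)) ->.
  by rewrite [avg u n i j]/avg; field.
have CS := grid_CauchySchwarz (eps n) (u n).
have CS' := grid_CauchySchwarz (eps n) (u n.-1).
have A_ge0 := grid_norm_ge0 (u n); have B_ge0 := grid_norm_ge0 (u n.-1).
have e_ge0 := grid_norm_ge0 (eps n).
have := grid_norm_sqr (u n); rewrite balance 2!mulrDr -grid_norm_sqr.
set A := grid_norm G (u n) in A_ge0 CS *; set B := grid_norm G (u n.-1) in B_ge0 CS' *.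
set e := grid_norm G (eps n) in e_ge0 CS CS' *.
move=> AE.
have diss' : h ^+ 2 * (2 * tau * lam * grid_sum (fun i j =>
    (avg v n i j + avg w n i j) * avg u n i j)) <= 0.
  by rewrite mulr_ge0_le0 ?sqr_ge0// mulr_ge0_le0// !mulr_ge0// ltW.
have energy : A ^+ 2 <= B ^+ 2 + tau * (e * A + e * B).
  rewrite AE lerD2l -[leRHS]add0r lerD// mulrCA ler_wpM2l ?(ltW tau_gt0)//.
  by rewrite mulrDr lerD.
(* Arguing by contradiction avoids dividing by [A + B], which may vanish: [lt_A] makes it
   positive. *)
rewrite leNgt; apply/negP => lt_A.
have te_ge0 : 0 <= tau * e by rewrite mulr_ge0// ltW.
have AB_gt0 : 0 < A + B by lra.
have := mulr_gt0 AB_gt0 (_ : 0 < A - (B + tau * e)).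
rewrite subr_gt0 => /(_ lt_A).
have -> : (A + B) * (A - (B + tau * e)) = A ^+ 2 - (B ^+ 2 + tau * (e * A + e * B)).
  by ring.
by rewrite subr_gt0 ltNge energy.
Qed.

End GridFunctions.

(** * Accumulation over the time levels and comparison of constants *)

Theorem theorem4p6 (R : realType)
  (lam T L1 L2 : R) (lam_gt0 : 0 < lam) (T_gt0 : 0 < T)
  (L1_gt0 : 0 < L1) (L2_gt0 : 0 < L2)
  (M1c M2c Nc kh kt : nat)
  (M1c_gt0 : (0 < M1c)%N) (M2c_gt0 : (0 < M2c)%N) (Nc_gt0 : (0 < Nc)%N)
  (kh_gt0 : (0 < kh)%N) (kt_gt0 : (0 < kt)%N)
  (hc : R) (hc_gt0 : 0 < hc)
  (L1E : L1 = hc * M1c%:R) (L2E : L2 = hc * M2c%:R)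
  (Gc Gf : grid R)
  (GcE : Gc = Grid hc (T / Nc%:R) M1c M2c Nc)
  (GfE : Gf = refine_grid kh kt Gc)
  (u0 : R * R -> R)
  (uc vc wc : nat -> int -> int -> R)
  (step1 : nonlinear_scheme Gc lam u0 uc vc wc)
  (uf vf wf : nat -> int -> int -> R)
  (step2 : interpolation Gc kh kt uc uf vf wf)
  (eta : int -> int -> R) (eta_Vh : in_Vh Gf eta)
  (eps : nat -> int -> int -> R)
  (eps_Vh : forall n : nat, (1 <= n <= levels Gf)%N -> in_Vh Gf (eps n))
  (uh vh wh : nat -> int -> int -> R)
  (residual : residual_system Gf lam uf vf wf eps eta uh vh wh)
  (n : nat) (n_range : (1 <= n <= levels Gf)%N) :
  grid_norm Gf (uh n) ^+ 2
  <= expR (2 * T) * (2 * grid_norm Gf eta ^+ 2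
       + 2 * tstep Gf * \sum_(1 <= k < n.+1) grid_norm Gf (eps k) ^+ 2).
Proof.
have hE : hstep Gf = hc / kh%:R by rewrite GfE GcE.
have tE : tstep Gf = T / Nc%:R / kt%:R by rewrite GfE GcE.
have NE : levels Gf = (kt * Nc)%N by rewrite GfE GcE.
have h_gt0 : 0 < hstep Gf by rewrite hE divr_gt0 ?ltr0n.
have t_gt0 : 0 < tstep Gf by rewrite tE !divr_gt0 ?ltr0n.
have perUVW : forall k, (k <= levels Gf)%N ->
    [/\ in_Vh Gf (uf k), in_Vh Gf (vf k) & in_Vh Gf (wf k)].
  by case: step2 => + _ _ _; rewrite GfE.
have init : grid_norm Gf (uh 0%N) = grid_norm Gf eta.
  case: residual => _ _ _ u0E; rewrite /grid_norm; congr (Num.sqrt (_ * _)).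
  by apply: (@eq_grid_sum _ Gf (fun i j => uh 0%N i j ^+ 2)
    (fun i j => eta i j ^+ 2)) => i j /u0E ->.
have growth m : (m <= levels Gf)%N ->
    grid_norm Gf (uh m)
    <= grid_norm Gf eta + tstep Gf * \sum_(1 <= k < m.+1) grid_norm Gf (eps k).
  elim: m => [|m IHm] mN; first by rewrite big_geq// mulr0 addr0 init.
  apply: le_trans (residual_system_step h_gt0 t_gt0 (ltW lam_gt0) perUVW residual _) _.
    by rewrite mN.
  by rewrite big_nat_recr//= mulrDr addrA lerD2r IHm// ltnW.
have /andP[n1 nN] := n_range.
have := growth n nN.
set E := \sum_(1 <= k < n.+1) _.
set Q := \sum_(1 <= k < n.+1) _.
set x := grid_norm Gf eta; set t := tstep Gf => le_u.
have E2 : E ^+ 2 <= n%:R * Q.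
  (* Cauchy-Schwarz against the constant 1, over the [n] levels from 1 to [n]. *)
  have := sum_CauchySchwarz (index_iota 1 n.+1) (fun=> 1) (fun k => grid_norm Gf (eps k)).
  rewrite (eq_bigr (fun k => grid_norm Gf (eps k))) => [|k _]; last by rewrite mul1r.
  rewrite [X in _ <= X * _](eq_bigr (fun=> 1)) => [|k _]; last by rewrite expr1n.
  by rewrite sumr_const_nat subn1.
have Q_ge0 : 0 <= Q by apply: sumr_ge0 => k _; exact: sqr_ge0.
have tn_le : t * n%:R <= T.
  have -> : T = t * (levels Gf)%:R.
    rewrite /t tE NE natrM; field.
    by rewrite !pnatr_eq0 -!lt0n Nc_gt0 kt_gt0.
  by rewrite ler_wpM2l ?ler_nat// ltW.
have exp_ge : 1 + 2 * T <= expR (2 * T) by exact: expR_ge1Dx.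
(* Both follow from [1 + 2 * T <= expR (2 * T)] and [T > 0]. *)
have [exp_ge1 exp_geT] : 1 <= expR (2 * T) /\ T <= expR (2 * T) by split; lra.
have bound : grid_norm Gf (uh n) ^+ 2 <= 2 * x ^+ 2 + T * (2 * t * Q).
  have le2 : grid_norm Gf (uh n) ^+ 2 <= (x + t * E) ^+ 2.
    rewrite ler_sqr ?nnegrE ?grid_norm_ge0//.
    exact: le_trans (grid_norm_ge0 _ _) le_u.
  apply: (le_trans le2).
  (* This square yields (x + t E)^2 <= 2 x^2 + 2 t^2 E^2, the source of both factors 2 in the
     bound. *)
  have sq := sqr_ge0 (x - t * E).
  have tE2 : t ^+ 2 * E ^+ 2 <= T * (t * Q).
    apply: (@le_trans _ _ (t ^+ 2 * (n%:R * Q))); first by rewrite ler_wpM2l ?sqr_ge0.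
    have -> : t ^+ 2 * (n%:R * Q) = (t * n%:R) * (t * Q) by ring.
    by rewrite ler_wpM2r// mulr_ge0// ltW.
  by nra.
apply: (le_trans bound); rewrite mulrDr lerD//.
  by rewrite ler_peMl// mulr_ge0 ?sqr_ge0.
by rewrite ler_wpM2r// !mulr_ge0// ltW.
Qed.
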